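(* Let $L\ge2$ be an integer and $k\in\{0,1,2,\dots\}$. The following identities of rational functions of $t$ hold: $$ {}_4F_3\left[\begin{matrix}-k,\ k+2,\ L,\ L+\frac12\\ -t+L+1,\ t+L+1,\ \frac32\end{matrix}\,\Big|\,1\right]=\frac1{2(k+1)(1-2L)t}\left[\frac{(t-L)_{k+2}}{(t+L+1)_k}-\frac{(-t-L)_{k+2}}{(-t+L+1)_k}\right], $$ $$ {}_4F_3\left[\begin{matrix}-k,\ k+1,\ L,\ L+\frac12\\ -t+L+\frac12,\ t+L+\frac12,\ \frac32\end{matrix}\,\Big|\,1\right]=\frac1{2(k+\frac12)(1-2L)}\left[\frac{(t-L+\frac12)_{k+1}}{(t+L+\frac12)_k}+\frac{(-t-L+\frac12)_{k+1}}{(-t+L+\frac12)_k}\right], $$ $$ {}_4F_3\left[\begin{matrix}-k,\ k,\ L,\ L-\frac12\\ -t+L,\ t+L,\ \frac12\end{matrix}\,\Big|\,1\right]=\frac12\left[\frac{(t-L+1)_k}{(t+L)_k}+\frac{(-t-L+1)_k}{(-t+L)_k}\right]. $$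
   Context: $(x)_n=x(x+1)\cdots(x+n-1)$ is the Pochhammer symbol. ${}_4F_3$ denotes the generalized hypergeometric series, which terminates here because of the upper parameter $-k$ and thus is a rational function of $t$. *)

(* Defs.v *)
From HB Require Import structures.
From mathcomp Require Export all_boot all_order all_algebra.
From mathcomp Require Export boolp classical_sets fsbigop.

Set Implicit Arguments.
Unset Strict Implicit.
Unset Printing Implicit Defensive.

Import GRing.Theory.
Local Open Scope classical_set_scope.
Local Open Scope ring_scope.

Definition pochhammer (R : nzRingType) (x : R) (n : nat) : R :=
  \prod_(i < n) (x + i%:R).

Definition hyp_term (K : fieldType) (us ls : seq K) (z : K) (n : nat) : K :=
  (\prod_(a <- us) pochhammer a n) / (\prod_(b <- ls) pochhammer b n)
  * (z ^+ n / n`!%:R).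

(* The whole hypergeometric series with upper parameters us and lower
   parameters ls, as a finitely supported sum over nat.  The sum would be 0 by
   convention if infinitely many terms were nonzero; lemma hyp_terminating
   shows that this does not occur when some upper parameter is a nonpositive
   integer. *)
Definition hypF (K : fieldType) (us ls : seq K) (z : K) : K :=
  \sum_(n \in [set: nat]) hyp_term us ls z n.

Definition hyp4F3 (K : fieldType) (a1 a2 a3 a4 b1 b2 b3 z : K) : K :=
  hypF [:: a1; a2; a3; a4] [:: b1; b2; b3] z.

Lemma pochhammer_opp_eq0 (R : nzRingType) (k n : nat) :
  (k < n)%N -> pochhammer (- k%:R : R) n = 0.
Proof.
elim: n => [|n IHn] //; rewrite ltnS leq_eqVlt /pochhammer big_ord_recr /=.
by case/orP=> [/eqP <-|/IHn]; [rewrite addNr mulr0 | rewrite /pochhammer => ->; rewrite mul0r].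
Qed.

Lemma hyp_terminating (K : fieldType) (us ls : seq K) (z : K) (k : nat) :
  - k%:R \in us -> hypF us ls z = \sum_(n < k.+1) hyp_term us ls z n.
Proof.
move=> k_us; rewrite fsbig_ord; apply/esym/fsbig_widen => // n /= [_ /negP].
rewrite -leqNgt => lt_kn; rewrite /hyp_term (big_rem _ k_us) /=.
by rewrite pochhammer_opp_eq0 // !mul0r.
Qed.

(* Main.v *)
(** Put f_k(t) = (t-L+1)_k / (t+L)_k, so that
    (t+L+k) f_{k+1}(t) = (t-L+1+k) f_k(t) and f_0 = 1.  The third identity gives
    the even part of f_k in t; the first one, with k replaced by k-1 and up to
    the factor k(1-2L)t/(t^2-L^2), gives its odd part.  The two are proved
    together: adding the n-th summand of the odd part to the (n+1)-st summand
    of the even part yields terms for which the first-order recurrence in k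
    telescopes in n, with a closed product form that vanishes for n > k.  The
    second identity is the even part of (t-L+1/2)_{k+1} / (t+L+1/2)_k, whose odd
    part is another 4F3, and is handled in the same way. *)
Require Import Defs.
From mathcomp Require Import ring.
Set Implicit Arguments.
Unset Strict Implicit.
Unset Printing Implicit Defensive.
Import GRing.Theory.
Local Open Scope ring_scope.

(** * Recurrences for the Pochhammer symbol *)

Section Pochhammer.
Variables (R : comNzRingType).
Implicit Types (x : R) (n : nat).

Lemma pochhammer0 x : pochhammer x 0 = 1.
Proof. exact: big_ord0. Qed.

Lemma pochhammerS x n : pochhammer x n.+1 = pochhammer x n * (x + n%:R).
Proof. exact: big_ord_recr. Qed.

Lemma pochhammerSl x n : pochhammer x n.+1 = x * pochhammer (x + 1) n.
Proof.
rewrite /pochhammer big_ord_recl /= addr0; congr (_ * _).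
by apply: eq_bigr => i _; rewrite -addrA nat1r.
Qed.

(** The two sides split the first or the last factor off the same product. This moves the base by
    one without dividing by [x], which may be zero. *)
Lemma pochhammer_shift x n :
  x * pochhammer (x + 1) n = pochhammer x n * (x + n%:R).
Proof. by rewrite -pochhammerSl pochhammerS. Qed.
End Pochhammer.

Lemma pochhammer_neq0 (K : fieldType) (x : K) n :
  (forall i, x + i%:R != 0) -> pochhammer x n != 0.
Proof. by move=> x_nz; apply/prodf_neq0 => i _. Qed.

(** * Telescoping sums over a field of characteristic 0 *)

Section Telescoping.
Variables (K : fieldType).
Hypothesis natK0 : forall n, n.+1%:R != 0 :> K.
Variable L : K.

Let two_neq0 : 2 != 0 :> K. Proof. exact: natK0. Qed.

Lemma two_add1_neq0 n : 2 * n%:R + 1 != 0 :> K.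
Proof. by rewrite -natrM natr1 natK0. Qed.

Lemma half_add_neq0 n : 1 / 2 + n%:R != 0 :> K.
Proof.
have -> : 1 / 2 + n%:R = (2 * n%:R + 1) / 2 :> K by field.
by rewrite mulf_neq0 ?two_add1_neq0 ?invr_eq0.
Qed.

(** The lower parameters of the even and odd parts, 1/2 and 3/2, are thereby reduced to the single
    symbol (1/2)_n. *)
Lemma pochhammer_threehalves n :
  pochhammer (3 / 2) n = pochhammer (1 / 2) n * (2 * n%:R + 1) :> K.
Proof.
have := pochhammer_shift (1 / 2 : K) n.
have -> : 1 / 2 + 1 = 3 / 2 :> K by field.
by move=> h; apply: (mulfI (half_add_neq0 0)); rewrite addr0 h; field.
Qed.

Lemma fact_natr_neq0 n : n`!%:R != 0 :> K.
Proof. by rewrite -(prednK (fact_gt0 n)). Qed.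

Definition even_term (k t : K) n : K :=
  hyp_term [:: - k; k; L; L - 1 / 2] [:: - t + L; t + L; 1 / 2] 1 n.

(* Since [- (- k)_{n+1} = k (1 - k)_n], this is, up to a factor independent of
   [n], the n-th term of the first series of the theorem with [k - 1] for [k]. *)
Definition odd_term (k t : K) n : K :=
  - 2 * t * (pochhammer (- k) n.+1 * pochhammer (k + 1) n * pochhammer L n *
     pochhammer (L - 1 / 2) n.+1) /
  (pochhammer (- t + L) n.+1 * pochhammer (t + L) n.+1 *
     pochhammer (3 / 2) n * n`!%:R).

(** The leading [2 * L - 1] is (t+L+k) - (t-L+1+k), the contribution of the even term of index 0,
    which equals 1. Induction on [N] leaves one rational identity per step, valid for every scalar
    [k]. *)
Lemma telescope_int (k t : K) N :
    (forall i, t + L + i%:R != 0) -> (forall i, - t + L + i%:R != 0) ->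
  (2 * L - 1) + \sum_(n < N)
     ((t + L + k) * (odd_term (k + 1) t n + even_term (k + 1) t n.+1)
      - (t - L + 1 + k) * (odd_term k t n + even_term k t n.+1))
  = (2 * L - 1) * (pochhammer (- k) N * pochhammer (k + 1) N * pochhammer L N *
      pochhammer (L + 1 / 2) N) / (pochhammer (- t + L) N * pochhammer (t + L) N
      * pochhammer (1 / 2) N * N`!%:R).
Proof.
move=> tL_nz NtL_nz; elim: N => [|n IHn].
  by rewrite big_ord0 !pochhammer0 fact0 addr0 !mulr1 divr1.
rewrite big_ord_recr /= addrA IHn /odd_term /even_term /hyp_term.
rewrite !big_cons !big_nil expr1n factS natrM.
rewrite (pochhammerSl (L - 1 / 2)) (pochhammerSl (- (k + 1))).
have -> : L - 1 / 2 + 1 = L + 1 / 2 by field.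
have -> : - (k + 1) + 1 = - k by ring.
rewrite pochhammer_threehalves.
have := pochhammer_shift (k + 1) n; rewrite (pochhammerSl k).
move: (pochhammer (k + 1 + 1) n) => z; rewrite !pochhammerS.
have := @pochhammer_neq0 K _ n tL_nz; move: (pochhammer (t + L) n) => Pp.
have := @pochhammer_neq0 K _ n NtL_nz; move: (pochhammer (- t + L) n) => Pm.
have := @pochhammer_neq0 K _ n half_add_neq0; move: (pochhammer (1 / 2) n) => Ph.
have := fact_natr_neq0 n; move: n`!%:R => Pf.
have := two_add1_neq0 n; have := natK0 n; rewrite -natr1.
have := tL_nz n; have := NtL_nz n; move: n%:R => m.
move=> nz1 nz2 nz3 nz9 nz5 nz6 nz7 nz8 zE.
(* The factor k+1 split off (-(k+1))_{n+1} is placed next to z = (k+2)_n, so that [zE] eliminates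
   [z] without assuming k+1 nonzero. *)
have -> : - 2 * t * (- (k + 1) * pochhammer (- k) n * z * pochhammer L n *
  ((L - 1 / 2) * pochhammer (L + 1 / 2) n)) = 2 * t * (pochhammer (- k) n *
   ((k + 1) * z) * pochhammer L n *
  ((L - 1 / 2) * pochhammer (L + 1 / 2) n)) by ring.
rewrite zE.
by field; rewrite two_neq0 nz5 nz3 addrC (mulrC m) nz9 nz6 nz2 nz8 nz1 nz7.
Qed.

(** The scalar in front clears the prefactor of the second identity, so that these terms sum to the
    even part itself. *)
Definition half_even_term (k t : K) n : K :=
  (k + 1 / 2) * (1 - 2 * L) * hyp_term [:: - k; k + 1; L; L + 1 / 2]
    [:: - t + L + 1 / 2; t + L + 1 / 2; 3 / 2] 1 n.

Definition half_odd_term (k t : K) n : K :=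
  t * hyp_term [:: - k; k + 1; L; L - 1 / 2]
    [:: - t + L + 1 / 2; t + L + 1 / 2; 1 / 2] 1 n.

(** Even and odd terms are paired at equal index here, and the index [N] of the closed form is that
    of the last summand; the induction therefore starts from one term. *)
Lemma telescope_half (k t : K) N :
    (forall i, t + L + 1 / 2 + i%:R != 0) ->
    (forall i, - t + L + 1 / 2 + i%:R != 0) ->
  \sum_(n < N.+1)
     ((t + L + 1 / 2 + k) * (half_even_term (k + 1) t n + half_odd_term (k + 1) t n)
      - (t - L + 3 / 2 + k) * (half_even_term k t n + half_odd_term k t n))
  = - 2 * (2 * L - 1) * (k + 1) * (pochhammer (- k) N * pochhammer (k + 2) N *
      pochhammer L N.+1 * pochhammer (L + 1 / 2) N) /
    (pochhammer (- t + L + 1 / 2) N * pochhammer (t + L + 1 / 2) N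
      * pochhammer (3 / 2) N * N`!%:R).
Proof.
move=> tL_nz NtL_nz; elim: N => [|n IHn].
  rewrite big_ord1 /half_even_term /half_odd_term /hyp_term.
  rewrite !big_cons !big_nil !pochhammerS !pochhammer0 fact0; field.
  by rewrite oner_neq0 two_neq0.
rewrite big_ord_recr /= IHn /half_odd_term /half_even_term /hyp_term.
rewrite !big_cons !big_nil expr1n factS natrM.
rewrite !pochhammer_threehalves.
rewrite (pochhammerSl (L - 1 / 2)) (pochhammerSl (- (k + 1))) (pochhammerSl (k + 1)).
have -> : L - 1 / 2 + 1 = L + 1 / 2 by field.
have -> : - (k + 1) + 1 = - k by ring.
have -> : k + 1 + 1 = k + 2 by ring.
rewrite !pochhammerS.
have := @pochhammer_neq0 K _ n tL_nz; move: (pochhammer (t + L + 1 / 2) n) => Pp.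
have := @pochhammer_neq0 K _ n NtL_nz; move: (pochhammer (- t + L + 1 / 2) n) => Pm.
have := @pochhammer_neq0 K _ n half_add_neq0; move: (pochhammer (1 / 2) n) => Ph.
have := fact_natr_neq0 n; move: n`!%:R => Pf.
have := two_add1_neq0 n.+1; have := two_add1_neq0 n; have := natK0 n; rewrite -natr1.
have := tL_nz n; have := NtL_nz n; move: n%:R => m.
move=> nz1 nz2 nz3 nz4 nz5 nz6 nz7 nz8 nz9.
(* [field] states its side conditions with the halves cleared. *)
have double_nz x : x + 1 / 2 + m != 0 -> x * 2 + 1 + m * 2 != 0.
  apply: contraNneq => x0.
  have -> : x + 1 / 2 + m = (x * 2 + 1 + m * 2) / 2 by field.
  by rewrite x0 mul0r.
field; rewrite two_neq0 nz6 nz3 nz5 addrC (mulrC m) nz4 nz7 nz9 nz8.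
by rewrite !(mulrC 2) !double_nz.
Qed.

Lemma odd_term_eq0 k n (t : K) : (k <= n)%N -> odd_term k%:R t n = 0.
Proof. by move=> le_kn; rewrite /odd_term pochhammer_opp_eq0 // !(mul0r, mulr0). Qed.

Lemma hyp_term_eq0 us ls k n :
  (k < n)%N -> hyp_term [:: - k%:R & us] ls (1 : K) n = 0.
Proof. by move=> lt_kn; rewrite /hyp_term big_cons pochhammer_opp_eq0 // !mul0r. Qed.

(** * Pochhammer quotients as sums of even and odd terms *)

Section ClosedForms.
Variable t : K.

(** The bound [N] stays fixed during the induction on [k], so that the sums for k and k+1 have the
    same range; once k < N the telescoped right-hand side contains (-k)_N = 0. *)
Lemma ratio_int k N :
    (forall i, t + L + i%:R != 0) -> (forall i, - t + L + i%:R != 0) ->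
    (k <= N)%N ->
  pochhammer (t - L + 1) k / pochhammer (t + L) k
  = 1 + \sum_(n < N) (odd_term k%:R t n + even_term k%:R t n.+1).
Proof.
move=> tL_nz NtL_nz; elim: k => [|k IHk] le_kN.
  rewrite !pochhammer0 divr1 big1 ?addr0 // => n _.
  by rewrite odd_term_eq0 // /even_term hyp_term_eq0 ?addr0.
have := telescope_int k%:R N tL_nz NtL_nz.
rewrite pochhammer_opp_eq0 // !(mul0r, mulr0) sumrB -!mulr_sumr natr1.
have /(congr1 (+%R (-1))) := IHk (ltnW le_kN); rewrite addKr => <-.
rewrite !pochhammerS; move: (\sum_(_ < _) _) => S.
have := tL_nz k; have := pochhammer_neq0 k tL_nz.
move: (pochhammer (t + L) k) => q; move: (pochhammer (t - L + 1) k) => p.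
move: k%:R => m q_nz m_nz.
set r := (_ / q) => h; apply: (mulfI m_nz).
(* This is the first-order recurrence in k, read off from the vanishing telescoped sum [h]. *)
have -> : (t + L + m) * (1 + S) = (t - L + 1 + m) * r.
  by apply/eqP; rewrite -subr_eq0 -h; apply/eqP; ring.
rewrite /r; field.
by rewrite q_nz.
Qed.

Lemma ratio_half k N :
    (forall i, t + L + 1 / 2 + i%:R != 0) ->
    (forall i, - t + L + 1 / 2 + i%:R != 0) -> (k <= N)%N ->
  pochhammer (t - L + 1 / 2) k.+1 / pochhammer (t + L + 1 / 2) k
  = \sum_(n < N.+1) (half_even_term k%:R t n + half_odd_term k%:R t n).
Proof.
move=> tL_nz NtL_nz; elim: k => [|k IHk] le_kN.
  (* For k = 0 only n = 0 survives, and (1/2)(1-2L) + t = t-L+1/2. *)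
  rewrite !pochhammerS !pochhammer0 big_ord_recl big1 => [|n _].
    rewrite /half_even_term /half_odd_term /hyp_term !big_cons !big_nil.
    by rewrite !pochhammer0 fact0; field; rewrite two_neq0 oner_neq0.
  by rewrite /half_even_term /half_odd_term !hyp_term_eq0 // !mulr0 addr0.
have := telescope_half k%:R N tL_nz NtL_nz.
rewrite pochhammer_opp_eq0 // !(mul0r, mulr0) sumrB -!mulr_sumr natr1.
rewrite -(IHk (ltnW le_kN)).
rewrite (pochhammerS _ k.+1) (pochhammerS (t + L + 1 / 2)) -(natr1 k).
move: (\sum_(_ < _) _) => S.
have := tL_nz k; have := pochhammer_neq0 k tL_nz.
move: (pochhammer (t + L + 1 / 2) k) => q.
move: (pochhammer (t - L + 1 / 2) k.+1) => p.
move: k%:R => m q_nz m_nz /eqP; rewrite subr_eq0 => /eqP h.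
apply: (mulfI m_nz); rewrite h.
(* The numerator symbol has one factor more than the denominator, so its next factor is shifted by
   m+1 rather than m. *)
have -> : t - L + 3 / 2 + m = t - L + 1 / 2 + (m + 1) by field.
by move: (_ + _ + m) m_nz => d d_nz; field; rewrite two_neq0 q_nz.
Qed.

End ClosedForms.

(** * Parity in [t]: changing its sign swaps two lower parameters *)

Lemma even_termN k t n : even_term k (- t) n = even_term k t n.
Proof.
by rewrite /even_term /hyp_term !big_cons opprK (mulrCA (pochhammer (t + L) n)).
Qed.

Lemma odd_termN k t n : odd_term k (- t) n = - odd_term k t n.
Proof.
rewrite /odd_term opprK (mulrC (pochhammer (t + L) n.+1)).
by rewrite !(mulrN, mulNr).
Qed.

Lemma half_even_termN k t n : half_even_term k (- t) n = half_even_term k t n.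
Proof.
rewrite /half_even_term /hyp_term !big_cons opprK.
by rewrite (mulrCA (pochhammer (t + L + 1 / 2) n)).
Qed.

Lemma half_odd_termN k t n : half_odd_term k (- t) n = - half_odd_term k t n.
Proof.
rewrite /half_odd_term /hyp_term !big_cons opprK.
by rewrite (mulrCA (pochhammer (t + L + 1 / 2) n)) mulNr.
Qed.

Lemma ratio_intN (t : K) k N :
    (forall i, t + L + i%:R != 0) -> (forall i, - t + L + i%:R != 0) ->
    (k <= N)%N ->
  pochhammer (- t - L + 1) k / pochhammer (- t + L) k
  = 1 + \sum_(n < N) (even_term k%:R t n.+1 - odd_term k%:R t n).
Proof.
move=> tL_nz NtL_nz le_kN.
rewrite (@ratio_int (- t) k N) // => [|i]; last by rewrite opprK.
by congr (_ + _); apply: eq_bigr => n _; rewrite even_termN odd_termN addrC.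
Qed.

Lemma ratio_halfN (t : K) k N :
    (forall i, t + L + 1 / 2 + i%:R != 0) ->
    (forall i, - t + L + 1 / 2 + i%:R != 0) -> (k <= N)%N ->
  pochhammer (- t - L + 1 / 2) k.+1 / pochhammer (- t + L + 1 / 2) k
  = \sum_(n < N.+1) (half_even_term k%:R t n - half_odd_term k%:R t n).
Proof.
move=> tL_nz NtL_nz le_kN.
rewrite (@ratio_half (- t) k N) // => [|i]; last by rewrite opprK.
by apply: eq_bigr => n _; rewrite half_even_termN half_odd_termN.
Qed.

(** * The three identities over a field *)

Lemma hyp4F3_even (t : K) k :
    (forall i, t + L + i%:R != 0) -> (forall i, - t + L + i%:R != 0) ->
  hyp4F3 (- k%:R) k%:R L (L - 1 / 2) (- t + L) (t + L) (1 / 2) 1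
  = 1 / 2 * (pochhammer (t - L + 1) k / pochhammer (t + L) k
             + pochhammer (- t - L + 1) k / pochhammer (- t + L) k).
Proof.
move=> tL_nz NtL_nz; rewrite /hyp4F3 (@hyp_terminating _ _ _ _ k) ?mem_head //.
rewrite (ratio_int tL_nz NtL_nz (leqnn k)) (ratio_intN tL_nz NtL_nz (leqnn k)).
(* The odd sums cancel between t and -t; the term n = 0 of the series supplies the constant 1. *)
rewrite big_ord_recl sumrB big_split /= -/(even_term _ _ _).
under eq_bigr do rewrite -/(even_term _ _ _).
have -> : even_term k%:R t 0 = 1.
  by rewrite /even_term /hyp_term !big_cons !big_nil !pochhammer0 fact0
     !(mulr1, divr1).
by field; rewrite two_neq0.
Qed.

Lemma hyp4F3_half (t : K) k :
    1 - 2 * L != 0 ->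
    (forall i, t + L + 1 / 2 + i%:R != 0) ->
    (forall i, - t + L + 1 / 2 + i%:R != 0) ->
  hyp4F3 (- k%:R) (k%:R + 1) L (L + 1 / 2)
    (- t + L + 1 / 2) (t + L + 1 / 2) (3 / 2) 1
  = 1 / (2 * (k%:R + 1 / 2) * (1 - 2 * L))
    * (pochhammer (t - L + 1 / 2) k.+1 / pochhammer (t + L + 1 / 2) k
       + pochhammer (- t - L + 1 / 2) k.+1 / pochhammer (- t + L + 1 / 2) k).
Proof.
move=> L_nz tL_nz NtL_nz.
rewrite /hyp4F3 (@hyp_terminating _ _ _ _ k) ?mem_head //.
rewrite (ratio_half tL_nz NtL_nz (leqnn k)) (ratio_halfN tL_nz NtL_nz (leqnn k)).
rewrite sumrB big_split /= /half_even_term -!mulr_sumr.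
have := two_add1_neq0 k; move: k%:R => m => m_nz; field.
by rewrite two_neq0 L_nz mulrC m_nz.
Qed.

Lemma hyp4F3_odd (t : K) k :
    1 - 2 * L != 0 -> t != 0 ->
    (forall i, t + L + i%:R != 0) -> (forall i, - t + L + i%:R != 0) ->
  hyp4F3 (- k%:R) (k%:R + 2) L (L + 1 / 2)
    (- t + L + 1) (t + L + 1) (3 / 2) 1
  = 1 / (2 * (k%:R + 1) * (1 - 2 * L) * t)
    * (pochhammer (t - L) k.+2 / pochhammer (t + L + 1) k
       - pochhammer (- t - L) k.+2 / pochhammer (- t + L + 1) k).
Proof.
move=> L_nz t_nz tL_nz NtL_nz.
rewrite /hyp4F3 (@hyp_terminating _ _ _ _ k) ?mem_head //.
have tL0 := tL_nz 0; have NtL0 := NtL_nz 0; rewrite !addr0 in tL0 NtL0.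
have tL1 x : (forall i, x + i%:R != 0) -> forall i, x + 1 + i%:R != 0 :> K.
  by move=> x_nz i; rewrite -addrA nat1r.
(* The factor (x-L)(x+L) takes the same value at t and -t, so the difference of the two quotients
   isolates the odd part for k+1. *)
have scale x : x + L != 0 -> pochhammer (x - L) k.+2 / pochhammer (x + L + 1) k
    = (x - L) * (x + L) * (pochhammer (x - L + 1) k.+1 / pochhammer (x + L) k.+1).
  move=> xL_nz; rewrite (pochhammerSl (x - L)) (pochhammerSl (x + L)) invfM.
  by rewrite -!mulrA; congr (_ * _); rewrite [RHS]mulrCA mulVKf // mulrC.
rewrite !scale // (ratio_int tL_nz NtL_nz (leqnn _)) (ratio_intN tL_nz NtL_nz (leqnn _)).
rewrite sumrB big_split /=.
(* The scalar collects the first factors of the symbols of index n+1: -2t times -(k+1) times L-1/2,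
   over (-t+L)(t+L). *)
have -> : \sum_(i < k.+1) odd_term k.+1%:R t i =
  (k%:R + 1) * (2 * L - 1) * t / ((- t + L) * (t + L)) * \sum_(n < k.+1)
  hyp_term [:: - k%:R; k%:R + 2; L; L + 1 / 2]
    [:: - t + L + 1; t + L + 1; 3 / 2] 1 n.
  rewrite mulr_sumr; apply: eq_bigr => n _.
  rewrite /odd_term /hyp_term !big_cons !big_nil expr1n !pochhammerSl -(natr1 k).
  have -> : - (k%:R + 1) + 1 = - k%:R :> K by ring.
  have -> : k%:R + 1 + 1 = k%:R + 2 :> K by ring.
  have -> : L - 1 / 2 + 1 = L + 1 / 2 by field.
  have := @pochhammer_neq0 K _ n (tL1 _ tL_nz).
  have := @pochhammer_neq0 K _ n (tL1 _ NtL_nz).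
  have := fact_natr_neq0 n; have := half_add_neq0.
  rewrite pochhammer_threehalves.
  move=> /(@pochhammer_neq0 K _ n) nz1 nz2 nz3 nz4.
  by field; rewrite two_neq0 two_add1_neq0 nz1 nz2 nz3 nz4 tL0 NtL0.
have := natK0 k; rewrite -(natr1 k); move: (\sum_(_ < _) _) => S kS.
by field; rewrite two_neq0 L_nz t_nz kS tL0 NtL0.
Qed.

End Telescoping.

(** * Rational functions: X + a has degree one, hence is nonzero *)

Lemma tofracX_addC_neq0 (F : fieldType) (a : F) : tofrac 'X + tofrac a%:P != 0.
Proof. by rewrite -rmorphD tofrac_eq0 -size_poly_gt0 size_XaddC. Qed.

Lemma tofracNX_addC_neq0 (F : fieldType) (a : F) : - tofrac 'X + tofrac a%:P != 0.
Proof. by rewrite -oppr_eq0 opprD opprK -rmorphN -polyCN tofracX_addC_neq0. Qed.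

Theorem theorem6p1 (F : fieldType) (charF0 : [pchar F] =i pred0)
    (L k : nat) (hL : (2 <= L)%N) :
  let t : {fraction {poly F}} := tofrac 'X in
  [/\ hyp4F3 (- k%:R) (k%:R + 2) L%:R (L%:R + 1 / 2)
             (- t + L%:R + 1) (t + L%:R + 1) (3 / 2) 1
      = 1 / (2 * (k%:R + 1) * (1 - 2 * L%:R) * t)
        * (pochhammer (t - L%:R) (k + 2) / pochhammer (t + L%:R + 1) k
           - pochhammer (- t - L%:R) (k + 2) / pochhammer (- t + L%:R + 1) k),
      hyp4F3 (- k%:R) (k%:R + 1) L%:R (L%:R + 1 / 2)
             (- t + L%:R + 1 / 2) (t + L%:R + 1 / 2) (3 / 2) 1
      = 1 / (2 * (k%:R + 1 / 2) * (1 - 2 * L%:R))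
        * (pochhammer (t - L%:R + 1 / 2) (k + 1)
             / pochhammer (t + L%:R + 1 / 2) k
           + pochhammer (- t - L%:R + 1 / 2) (k + 1)
             / pochhammer (- t + L%:R + 1 / 2) k)
    & hyp4F3 (- k%:R) k%:R L%:R (L%:R - 1 / 2)
             (- t + L%:R) (t + L%:R) (1 / 2) 1
      = 1 / 2
        * (pochhammer (t - L%:R + 1) k / pochhammer (t + L%:R) k
           + pochhammer (- t - L%:R + 1) k / pochhammer (- t + L%:R) k)].
Proof.
move=> t.
have natF0 n : n.+1%:R != 0 :> F by rewrite ((pcharf0P F).1 charF0).
have natP n : n%:R = tofrac n%:R%:P :> {fraction {poly F}}.
  by rewrite polyC_natr rmorph_nat.
have halfP n : 1 / 2 + n%:R = tofrac (1 / 2 + n%:R)%:P :> {fraction {poly F}}.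
  rewrite -[RHS]/((@tofrac {poly F} \o polyC) _).
  by rewrite rmorphD fmorph_div /= rmorph1 !rmorph_nat.
have natK0 n : n.+1%:R != 0 :> {fraction {poly F}}.
  by rewrite natP tofrac_eq0 polyC_eq0.
have L_nz : 1 - 2 * L%:R != 0 :> {fraction {poly F}}.
  case: L hL => [|l] // _.
  have -> : 1 - 2 * l.+1%:R = - (2 * l%:R + 1) :> {fraction {poly F}}.
    by rewrite -(natr1 l); ring.
  by rewrite oppr_eq0 two_add1_neq0.
have t_nz : t != 0 by rewrite tofrac_eq0 polyX_eq0.
(* Since [t] is transcendental over [F], no denominator symbol vanishes and no quotient falls under
   the convention 1/0 = 0. *)
have tL_nz i : t + L%:R + i%:R != 0.
  by rewrite -addrA -natrD natP tofracX_addC_neq0.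
have NtL_nz i : - t + L%:R + i%:R != 0.
  by rewrite -addrA -natrD natP tofracNX_addC_neq0.
have tLh_nz i : t + L%:R + 1 / 2 + i%:R != 0.
  by rewrite -!addrA (addrCA L%:R) -natrD halfP tofracX_addC_neq0.
have NtLh_nz i : - t + L%:R + 1 / 2 + i%:R != 0.
  by rewrite -!addrA (addrCA L%:R) -natrD halfP tofracNX_addC_neq0.
split; rewrite ?addn1 ?addn2.
- exact: (hyp4F3_odd natK0 k L_nz t_nz tL_nz NtL_nz).
- exact: (hyp4F3_half natK0 k L_nz tLh_nz NtLh_nz).
- exact: (hyp4F3_even natK0 k tL_nz NtL_nz).
Qed.
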